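(* Let $n\ge 1$ and let $\rho_w: P_n\to P_n^e$ be the linear map $\rho_w(f)=\theta(w(f)\otimes 1)$. Then the product $$f*_w g=\rho_w^{-1}(\rho_w(f)\rho_w(g)),\qquad f,g\in P_n,$$ is the Moyal product on $P_n$, i.e., for all $f,g\in P_n$, $$f*_w g=\sum_{\alpha\in \mathbb{Z}_{+}^{2n}} \frac{(-1)^{|\alpha_2|}}{\alpha!\,2^{|\alpha|}}\, \partial^{\alpha}(f)\,\partial^{\alpha^*}(g).$$
   Context: $k$ is an arbitrary field of characteristic $0$. For a Poisson algebra $P$ (commutative associative with identity $1$, with a Lie bracket $\{\,,\}$ satisfying $\{x,yz\}=\{x,y\}z+y\{x,z\}$), the universal enveloping algebra $P^e$ is the associative unital $k$-algebra generated by two copies $m_P=\{m_a: a\in P\}$, $h_P=\{h_a: a\in P\}$ of the vector space $P$ (with $a\mapsto m_a$, $a\mapsto h_a$ linear) subject to the relations, for all $x,y\in P$: $m_{xy}=m_xm_y$, $h_{\{x,y\}}=h_xh_y-h_yh_x$, $h_{xy}=m_yh_x+m_xh_y$, $m_{\{x,y\}}=h_xm_y-m_yh_x$, $m_1=1$. The map $x\mapsto m_x$ is injective and $m_x$ is identified with $x$, so $P\subseteq P^e$. $P_n=k[x_1,\ldots,x_n,y_1,\ldots,y_n]$ with Poisson bracket determined by $\{x_i,y_j\}=\delta_{ij}$, $\{x_i,x_j\}=\{y_i,y_j\}=0$. $A_n$ is the Weyl algebra with generators $X_1,\ldots,X_n,Y_1,\ldots,Y_n$ and relations $[X_i,Y_j]=\delta_{ij}$,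 $[X_i,X_j]=[Y_i,Y_j]=0$. $A_n^e=A_n\otimes_k A_n^{op}$, with $':A_n\to A_n^{op}$ the canonical anti-isomorphism. $\theta:A_n^e\to P_n^e$ is the unique algebra isomorphism with $\theta(X_i\otimes 1)=x_i+\frac12h_{x_i}$, $\theta(1\otimes X_i')=x_i-\frac12h_{x_i}$, $\theta(Y_i\otimes 1)=y_i+\frac12h_{y_i}$, $\theta(1\otimes Y_i')=y_i-\frac12h_{y_i}$ for $1\le i\le n$. Symmetrization: $w:P_n\to A_n$ is the linear bijection defined by $w(l_1l_2\cdots l_p)=\frac1{p!}\sum_{\pi\in S_p}\hat l_{\pi(1)}\hat l_{\pi(2)}\cdots \hat l_{\pi(p)}$ for all $l_1,\ldots,l_p$ in the linear span of $x_1,\ldots,x_n,y_1,\ldots,y_n$, where $l\mapsto\hat l$ is the linear map with $x_i\mapsto X_i$, $y_i\mapsto Y_i$. Multi-indices: $\mathbb{Z}_+$ is the set of nonnegative integers; for $\alpha=(i_1,\ldots,i_t)$, $|\alpha|=i_1+\cdots+i_t$, $\alpha!=i_1!\cdots i_t!$. For $\alpha=(i_1,\ldots,i_n,j_1,\ldots,j_n)\in\mathbb{Z}_+^{2n}$ put $\alpha_1=(i_1,\ldots,i_n)$, $\alpha_2=(j_1,\ldots,j_n)$, $\alpha=(\alpha_1,\alpha_2)$, $\alpha^*=(\alpha_2,\alpha_1)$. $\partial^{\alpha}=\left(\frac{\partial}{\partial x_1}\right)^{i_1}\cdots\left(\frac{\partial}{\partial x_n}\right)^{i_n}\left(\frac{\partial}{\partial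 y_1}\right)^{j_1}\cdots\left(\frac{\partial}{\partial y_n}\right)^{j_n}$ with the usual partial derivatives of $P_n$. *)

(* Defs.v *)
From HB Require Import structures.
From mathcomp Require Import all_boot all_order all_fingroup all_algebra.
From mathcomp Require Import finmap generic_quotient ring_quotient.
From mathcomp Require Import boolp classical_sets fsbigop.
From mathcomp Require Import ring.
From mathcomp Require monalg.
From mathcomp Require Import mpoly.

Set Implicit Arguments.
Unset Strict Implicit.
Unset Printing Implicit Defensive.

Import GRing.Theory.
Local Open Scope ring_scope.
Local Open Scope quotient_scope.

(** * Quotient of an algebra by relations *)

Section RelIdeal.
Variables (A : nzRingType) (R : A -> A -> Prop).

(* The two-sided ideal generated by the differences [u - v] with [R u v]. *)
Inductive rel_ideal : A -> Prop :=
| rel_ideal_gen u v : R u v -> rel_ideal (u - v)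
| rel_ideal0 : rel_ideal 0
| rel_idealD u v : rel_ideal u -> rel_ideal v -> rel_ideal (u + v)
| rel_idealMl a u : rel_ideal u -> rel_ideal (a * u)
| rel_idealMr a u : rel_ideal u -> rel_ideal (u * a).

Definition in_rel_ideal : {pred A} := fun u => `[< rel_ideal u >].

Lemma in_rel_idealP u : reflect (rel_ideal u) (u \in in_rel_ideal).
Proof. exact: asboolP. Qed.

Fact in_rel_ideal_zmod_closed : zmod_closed in_rel_ideal.
Proof.
split=> [|u v /in_rel_idealP Iu /in_rel_idealP Iv]; apply/in_rel_idealP.
  exact: rel_ideal0.
by rewrite -mulN1r; apply: rel_idealD => //; apply: rel_idealMl.
Qed.

HB.instance Definition _ :=
  GRing.isZmodClosed.Build A in_rel_ideal in_rel_ideal_zmod_closed.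

(* [algType] excludes the zero ring, so the quotient is only an [algType] once
   the relations are known not to collapse it. *)
Definition consistent := ~ rel_ideal 1.

End RelIdeal.

Section QuotAlg.
Variables (k : fieldType) (A : algType k) (R : A -> A -> Prop).
Variable (cR : consistent R).

Definition quotalg of consistent R := Quotient.quot (in_rel_ideal R).
Local Notation Q := (quotalg cR).

HB.instance Definition _ := GRing.Zmodule.on Q.

Definition quotalg_pi (u : A) : Q := \pi_(Quotient.quot (in_rel_ideal R)) u.
Definition quotalg_repr (x : Q) : A :=
  generic_quotient.repr (x : Quotient.quot (in_rel_ideal R)).

Lemma quotalg_reprK : cancel quotalg_repr quotalg_pi.
Proof. exact: reprK. Qed.

Lemma quotalg_piP u v : quotalg_pi u = quotalg_pi v <-> rel_ideal R (u - v).
Proof.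
have e : (u - v \in in_rel_ideal R) = (quotalg_pi u == quotalg_pi v).
  exact: Quotient.idealrBE.
by split=> [/eqP|/in_rel_idealP]; [rewrite -e => /in_rel_idealP|rewrite e => /eqP].
Qed.

Lemma quotalg_rel u v : R u v -> quotalg_pi u = quotalg_pi v.
Proof. by move=> /rel_ideal_gen /quotalg_piP. Qed.

Fact quotalg_pi_zmod : zmod_morphism quotalg_pi.
Proof. by move=> u v; exact: (raddfB (\pi_(Quotient.quot (in_rel_ideal R)))). Qed.

(* The operations are locked to keep failing unifications cheap. *)
Fact quotalg_key : unit. Proof. exact: tt. Qed.
Definition quotalg_mul : Q -> Q -> Q := locked_with quotalg_key
  (fun x y => quotalg_pi (quotalg_repr x * quotalg_repr y)).
Definition quotalg_scale : k -> Q -> Q := locked_with quotalg_key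
  (fun c x => quotalg_pi (c *: quotalg_repr x)).

Lemma quotalg_repr_pi u : rel_ideal R (quotalg_repr (quotalg_pi u) - u).
Proof. by apply/quotalg_piP; rewrite quotalg_reprK. Qed.

Lemma quotalg_piM u v :
  quotalg_mul (quotalg_pi u) (quotalg_pi v) = quotalg_pi (u * v).
Proof.
rewrite /quotalg_mul unlock; apply/quotalg_piP; set u' := quotalg_repr _; set v' := quotalg_repr _.
have -> : u' * v' - u * v = (u' - u) * v' + u * (v' - v).
  by rewrite mulrBl mulrBr addrA addrNK.
by apply: rel_idealD; [apply: rel_idealMr|apply: rel_idealMl];
  apply: quotalg_repr_pi.
Qed.

Lemma quotalg_piZ c u : quotalg_scale c (quotalg_pi u) = quotalg_pi (c *: u).
Proof.
rewrite /quotalg_scale unlock; apply/quotalg_piP; rewrite -scalerBr -mulr_algl.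
by apply: rel_idealMl; apply: quotalg_repr_pi.
Qed.

Lemma quotalgE (P : Q -> Prop) : (forall u, P (quotalg_pi u)) -> forall x, P x.
Proof. by move=> Ppi x; rewrite -(quotalg_reprK x). Qed.

Let piD u v : quotalg_pi (u + v) = quotalg_pi u + quotalg_pi v.
Proof. exact: (raddfD (\pi_(Quotient.quot (in_rel_ideal R)))). Qed.

Fact quotalg_mulA : associative quotalg_mul.
Proof.
by do 3!elim/quotalgE=> ?; rewrite !quotalg_piM mulrA.
Qed.
Fact quotalg_mul1 : left_id (quotalg_pi 1) quotalg_mul.
Proof. by elim/quotalgE=> ?; rewrite quotalg_piM mul1r. Qed.
Fact quotalg_mulr1 : right_id (quotalg_pi 1) quotalg_mul.
Proof. by elim/quotalgE=> ?; rewrite quotalg_piM mulr1. Qed.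
Fact quotalg_mulDl : left_distributive quotalg_mul +%R.
Proof.
by do 3!elim/quotalgE=> ?; rewrite -piD !quotalg_piM -piD mulrDl.
Qed.
Fact quotalg_mulDr : right_distributive quotalg_mul +%R.
Proof.
by do 3!elim/quotalgE=> ?; rewrite -piD !quotalg_piM -piD mulrDr.
Qed.
Fact quotalg_1neq0 : quotalg_pi 1 != 0.
Proof.
apply/eqP => e; apply: cR; rewrite -[1]subr0; apply/quotalg_piP.
by rewrite e; apply/esym; exact: (raddf0 (\pi_(Quotient.quot (in_rel_ideal R)))).
Qed.

HB.instance Definition _ := GRing.Zmodule_isNzRing.Build Q quotalg_mulA
  quotalg_mul1 quotalg_mulr1 quotalg_mulDl quotalg_mulDr quotalg_1neq0.

Fact quotalg_scaleA a b (x : Q) :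
  quotalg_scale a (quotalg_scale b x) = quotalg_scale (a * b) x.
Proof. by elim/quotalgE: x => u; rewrite !quotalg_piZ scalerA. Qed.
Fact quotalg_scale1 : left_id 1 quotalg_scale.
Proof. by elim/quotalgE=> u; rewrite quotalg_piZ scale1r. Qed.
Fact quotalg_scaleDr : right_distributive quotalg_scale +%R.
Proof.
by move=> c; do 2!elim/quotalgE=> ?; rewrite -piD !quotalg_piZ -piD scalerDr.
Qed.
Fact quotalg_scaleDl (x : Q) : {morph quotalg_scale^~ x : a b / a + b}.
Proof.
by move=> a b; elim/quotalgE: x => u; rewrite !quotalg_piZ -piD scalerDl.
Qed.

HB.instance Definition _ := GRing.Zmodule_isLmodule.Build k Q quotalg_scaleA
  quotalg_scale1 quotalg_scaleDr quotalg_scaleDl.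

Fact quotalg_scaleAl (c : k) (x y : Q) : c *: (x * y) = (c *: x) * y.
Proof.
elim/quotalgE: x => u; elim/quotalgE: y => v.
by rewrite /GRing.scale /GRing.mul /= !(quotalg_piZ, quotalg_piM) scalerAl.
Qed.
HB.instance Definition _ := GRing.Lmodule_isLalgebra.Build k Q quotalg_scaleAl.

Fact quotalg_scaleAr (c : k) (x y : Q) : c *: (x * y) = x * (c *: y).
Proof.
elim/quotalgE: x => u; elim/quotalgE: y => v.
by rewrite /GRing.scale /GRing.mul /= !(quotalg_piZ, quotalg_piM) scalerAr.
Qed.
HB.instance Definition _ := GRing.Lalgebra_isAlgebra.Build k Q quotalg_scaleAr.

HB.instance Definition _ :=
  GRing.isZmodMorphism.Build A Q quotalg_pi quotalg_pi_zmod.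
Fact quotalg_pi_monoid : monoid_morphism quotalg_pi.
Proof. by split=> // u v; rewrite -quotalg_piM. Qed.
HB.instance Definition _ :=
  GRing.isMonoidMorphism.Build A Q quotalg_pi quotalg_pi_monoid.
Fact quotalg_pi_scalable : scalable quotalg_pi.
Proof. by move=> c u; rewrite -quotalg_piZ. Qed.
HB.instance Definition _ :=
  GRing.isScalable.Build k A Q *:%R quotalg_pi quotalg_pi_scalable.

Lemma quotalg_comm u v w : R (u * v - v * u) w ->
  quotalg_pi u * quotalg_pi v - quotalg_pi v * quotalg_pi u = quotalg_pi w.
Proof. by move=> /quotalg_rel <-; rewrite rmorphB !rmorphM. Qed.

End QuotAlg.

(** * Free algebras and their actions *)

Section FreeAlg.
(* Only imported locally: its notation [{mpoly _[_]}] shadows that of [mpoly]. *)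
Import monalg.
Variables (k : fieldType) (T : choiceType).

Definition freealg := {malg k[{fmonom T}]}.

HB.instance Definition _ := GRing.Lalgebra.on freealg.

Fact freealg_scaleAr (c : k) (u v : freealg) : c *: (u * v) = u * (c *: v).
Proof.
apply/malgP => m; rewrite mcoeffZ mcoeffMl.
rewrite (mcoeffMlw _ (fsubset_refl _) (msuppZ_le c v)).
rewrite mulr_sumr; apply: eq_bigr => m1 _.
rewrite mulr_sumr; apply: eq_bigr => m2 _.
by rewrite mcoeffZ mulrnAr mulrCA.
Qed.

HB.instance Definition _ :=
  GRing.Lalgebra_isAlgebra.Build k freealg freealg_scaleAr.

Fact fgen_key : unit. Proof. exact: tt. Qed.
Definition fgen : T -> freealg :=
  locked_with fgen_key (fun t => mkmalgU (fmu t) 1).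

Lemma fgenE t : fgen t = mkmalgU (fmu t) 1.
Proof. by rewrite /fgen unlock. Qed.

End FreeAlg.

(* Extending a family of linear endomorphisms [op t] of [V] to a left action of
   the free algebra shows that relations satisfied by the [op t] are
   consistent. *)
Section Action.
Import monalg.
Variables (k : fieldType) (T : choiceType) (V : lmodType k) (op : T -> V -> V).
Hypothesis op_lin : forall t, linear (op t).

Definition word_act (m : {fmonom T}) (x : V) : V := foldr op x m.
Definition freealg_act (g : freealg k T) (x : V) : V :=
  \sum_(m <- msupp g) mcoeff m g *: word_act m x.

Lemma word_act_lin m : linear (word_act m).
Proof.
by move=> c x y; rewrite /word_act; elim: (m : seq T) => //= t s ->; rewrite op_lin.
Qed.

Lemma freealg_actEw (d : {fset {fmonom T}}) (g : freealg k T) x :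
  (msupp g `<=` d)%fset ->
  freealg_act g x = \sum_(m <- d) mcoeff m g *: word_act m x.
Proof.
move=> le; rewrite /freealg_act (big_fset_incl _ le) => //= m md.
by move=> /mcoeff_outdom ->; rewrite scale0r.
Qed.

Lemma freealg_act_linr g : linear (freealg_act g).
Proof.
move=> c x y; rewrite /freealg_act scaler_sumr -big_split; apply: eq_bigr => m _.
by rewrite word_act_lin scalerDr !scalerA mulrC.
Qed.

Lemma freealg_actDl g1 g2 x :
  freealg_act (g1 + g2) x = freealg_act g1 x + freealg_act g2 x.
Proof.
pose d := (msupp g1 `|` msupp g2)%fset.
rewrite (@freealg_actEw d) ?msuppD_le //.
rewrite (@freealg_actEw d g1) ?fsubsetUl // (@freealg_actEw d g2) ?fsubsetUr //.
by rewrite -big_split; apply: eq_bigr => m _; rewrite mcoeffD scalerDl.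
Qed.

Lemma freealg_act0l x : freealg_act 0 x = 0.
Proof. by rewrite /freealg_act msupp0 big_nil. Qed.

Lemma freealg_actZl c g x : freealg_act (c *: g) x = c *: freealg_act g x.
Proof.
rewrite (@freealg_actEw (msupp g)) ?msuppZ_le // scaler_sumr.
by apply: eq_bigr => m _; rewrite mcoeffZ scalerA.
Qed.

Lemma freealg_actU m c x :
  freealg_act (mkmalgU m c) x = c *: word_act m x.
Proof.
rewrite (@freealg_actEw [fset m]%fset) ?msuppU_le // big_seq_fset1.
by rewrite mcoeffUU.
Qed.

Lemma freealg_act_suml I (r : seq I) (F : I -> freealg k T) x :
  freealg_act (\sum_(i <- r) F i) x = \sum_(i <- r) freealg_act (F i) x.
Proof.
exact: (big_morph (freealg_act^~ x) (fun g1 g2 => freealg_actDl g1 g2 x)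
  (freealg_act0l x)).
Qed.

Lemma freealg_actM g1 g2 x :
  freealg_act (g1 * g2) x = freealg_act g1 (freealg_act g2 x).
Proof.
rewrite [g1 * g2]malgME freealg_act_suml; apply: eq_bigr => m1 _.
rewrite freealg_act_suml [in RHS]/freealg_act.
have [f Ef] : exists f : {linear V -> V}, word_act m1 =1 f.
  pose c := GRing.isLinear.Build k V V *:%R (word_act m1) (word_act_lin m1).
  by exists (HB.pack (word_act m1) c : {linear V -> V}).
rewrite Ef linear_sum scaler_sumr; apply: eq_bigr => m2 _.
rewrite freealg_actU linearZ /= scalerA -Ef; congr (_ *: _).
by rewrite /word_act fmM foldr_cat.
Qed.

Lemma freealg_act1 x : freealg_act 1 x = x.
Proof. by rewrite freealg_actU scale1r /word_act fm1. Qed.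

Lemma freealg_act_gen t x : freealg_act (fgen k t) x = op t x.
Proof. by rewrite fgenE freealg_actU scale1r /word_act fmU. Qed.

Definition freealg_actE :=
  (freealg_actDl, freealg_act0l, freealg_actZl, freealg_actM, freealg_act1,
   freealg_act_gen).

Lemma freealg_actNl g x : freealg_act (- g) x = - freealg_act g x.
Proof. by rewrite -[- g]scaleN1r freealg_actZl scaleN1r. Qed.

Lemma consistent_act (R : freealg k T -> freealg k T -> Prop) (x0 : V) :
    x0 != 0 ->
    (forall u v, R u v -> forall x, freealg_act u x = freealg_act v x) ->
  consistent R.
Proof.
move=> x0_neq0 actR I1.
suff /(_ x0) : forall x, freealg_act 1 x = 0.
  by rewrite freealg_act1 => /eqP; rewrite (negPf x0_neq0).
have act0 g : freealg_act g 0 = 0.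
  by have := freealg_act_linr g (-1) 0 0; rewrite scaler0 add0r scaleN1r addNr.
elim: I1 => {x0 x0_neq0} [u v Ruv|||a u _ IHu|a u _ IHu] x; rewrite ?freealg_actE //.
- by rewrite freealg_actNl (actR _ _ Ruv) subrr.
- by move=> v _ IHu _ IHv y; rewrite freealg_actE IHu IHv addr0.
- by rewrite IHu act0.
Qed.

End Action.

(** * Poisson algebras and their universal enveloping algebras *)

Record poisson (k : fieldType) (P : comAlgType k) := Poisson {
  bracket :> P -> P -> P;
  bracket_linl : forall y, linear (bracket^~ y);
  bracket_linr : forall x, linear (bracket x);
  bracket_alt : forall x, bracket x x = 0;
  bracket_jacobi : forall x y z,
    bracket x (bracket y z) + bracket y (bracket z x) + bracket z (bracket x y)
      = 0;
  bracket_leibniz : forall x y z,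
    bracket x (y * z) = bracket x y * z + y * bracket x z
}.

Section EnvelopingAlgebra.
Variables (k : fieldType) (P : comAlgType k) (pb : poisson P).

(* The index type of the two copies of [P]. *)
Definition poisson_env_idx : choiceType := (P + P)%type.
Let m (a : P) : freealg k poisson_env_idx := fgen k (inl a : poisson_env_idx).
Let h (a : P) : freealg k poisson_env_idx := fgen k (inr a : poisson_env_idx).

Inductive poisson_env_rel : freealg k poisson_env_idx -> freealg k poisson_env_idx -> Prop :=
| env_rel_linm c x y : poisson_env_rel (m (c *: x + y)) (c *: m x + m y)
| env_rel_linh c x y : poisson_env_rel (h (c *: x + y)) (c *: h x + h y)
| env_rel_mM x y : poisson_env_rel (m (x * y)) (m x * m y)
| env_rel_hb x y : poisson_env_rel (h (pb x y)) (h x * h y - h y * h x)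
| env_rel_hM x y : poisson_env_rel (h (x * y)) (m y * h x + m x * h y)
| env_rel_mb x y : poisson_env_rel (m (pb x y)) (h x * m y - m y * h x)
| env_rel_m1 : poisson_env_rel (m 1) 1.

Let op (t : poisson_env_idx) (x : P) : P :=
  match t with inl a => a * x | inr a => pb a x end.

Lemma bracketC x y : pb x y = - pb y x.
Proof.
have addl a b c : pb (a + b) c = pb a c + pb b c.
  by have := bracket_linl pb c 1 a b; rewrite !scale1r.
have addr a b c : pb c (a + b) = pb c a + pb c b.
  by have := bracket_linr pb c 1 a b; rewrite !scale1r.
have := bracket_alt pb (x + y); rewrite addl !addr !bracket_alt add0r addr0.
by move/eqP; rewrite addr_eq0 => /eqP.
Qed.

Lemma bracketNr x y : pb x (- y) = - pb x y.
Proof.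
have pb0 : pb x 0 = 0.
  by have := bracket_linr pb x (-1) 0 0; rewrite scaler0 add0r scaleN1r addNr.
by have := bracket_linr pb x (-1) y 0; rewrite !addr0 !scaleN1r pb0 addr0.
Qed.

(* [P] is a module over its enveloping algebra. *)
Fact poisson_env_consistent : consistent poisson_env_rel.
Proof.
have op_lin t : linear (op t).
  by case: t => a c x y /=; rewrite ?bracket_linr // mulrDr scalerAr.
apply: (consistent_act op_lin (oner_neq0 P)) => u v.
have D := freealg_actDl op; have N := freealg_actNl op.
have Z := freealg_actZl op; have M := freealg_actM op_lin.
have G := freealg_act_gen op.
case=> [c x y|c x y|x y|x y|x y|x y|] z.
- by rewrite D Z !G /= mulrDl scalerAl.
- by rewrite D Z !G /= bracket_linl.
- by rewrite G M !G /= mulrA.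
- rewrite G D N [X in X - _]M [X in _ - X]M !G /=; apply/eqP.
  rewrite -subr_eq0 -oppr_eq0 -(bracket_jacobi pb x y z).
  by rewrite [pb z x]bracketC bracketNr [pb z (pb x y)]bracketC; apply/eqP; ring.
- rewrite G D [X in X + _]M [X in _ + X]M !G /= [LHS]bracketC bracket_leibniz ![pb z _]bracketC; ring.
- rewrite G D N [X in X - _]M [X in _ - X]M !G /= bracket_leibniz; ring.
- by rewrite G /= mul1r freealg_act1.
Qed.

Definition poisson_env := quotalg poisson_env_consistent.
HB.instance Definition _ := GRing.Algebra.on poisson_env.

(* [poisson_env_m] is the embedding identifying [P] with a subalgebra of [P^e]. *)
Definition poisson_env_m (a : P) : poisson_env := quotalg_pi poisson_env_consistent (m a).
Definition poisson_env_h (a : P) : poisson_env := quotalg_pi poisson_env_consistent (h a).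

End EnvelopingAlgebra.

(** * The Poisson algebra P_n *)

Lemma mderiv_var (R : nzRingType) n (i j : 'I_n) :
  ('X_j : {mpoly R[n]})^`M(i) = (i == j)%:R.
Proof.
rewrite mderivX mnm1E [j == i]eq_sym; case: eqP => [->|_]; last by rewrite scale0r.
by rewrite scale1r -{1}[U_(j)%MM]add0m addmK mpolyX0.
Qed.

Section Jacobi.
Variables (k : fieldType) (n : nat).
Local Notation P := {mpoly k[n]}.

Lemma derivation0 (D : P -> P) : linear D ->
    (forall f g, D (f * g) = D f * g + f * D g) -> (forall i, D 'X_i = 0) ->
  forall f, D f = 0.
Proof.
move=> D_lin D_leib D_var.
have D0 : D 0 = 0.
  by have := D_lin (-1) 0 0; rewrite scaler0 add0r scaleN1r addNr.
have D1 : D 1 = 0.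
  have := D_leib 1 1; rewrite !mulr1 mul1r => e.
  by apply: (addrI (D 1)); rewrite addr0 -e.
elim/mpolyind => // c m f _ _ Df; rewrite D_lin Df addr0 mpolyXE_id.
suff -> : D (\prod_(i < n) 'X_i ^+ m i) = 0 by rewrite scaler0.
apply: (big_ind (fun f => D f = 0)) => // [f1 f2 f10 f20|i _].
  by rewrite D_leib f10 f20 mul0r mulr0 addr0.
elim: (m i) => [|r IHr]; first by rewrite expr0.
by rewrite exprS D_leib D_var IHr mul0r mulr0 addr0.
Qed.

(* An alternating biderivation satisfies the Jacobi identity as soon as brackets
   of variables are central. *)
Lemma jacobi_var (br : P -> P -> P) :
    (forall f, linear (br f)) -> (forall f g, br f g = - br g f) ->
    (forall f g h, br f (g * h) = br f g * h + g * br f h) ->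
    (forall f i j, br f (br 'X_i 'X_j) = 0) ->
  forall f g h, br f (br g h) + br g (br h f) + br h (br f g) = 0.
Proof.
move=> br_lin brC br_leib br_var.
have brD a : {morph br a : b c / b + c}.
  by move=> b c; have := br_lin a 1 b c; rewrite !scale1r.
have br0 a : br a 0 = 0 by apply: (addrI (br a 0)); rewrite -brD !addr0.
have brZ a c x : br a (c *: x) = c *: br a x.
  by have := br_lin a c x 0; rewrite br0 !addr0.
have brN a b : br a (- b) = - br a b by rewrite -scaleN1r brZ scaleN1r.
pose J f g h := br f (br g h) + br g (br h f) + br h (br f g).
have JC a b c : J a b c = J b c a by rewrite /J -addrA addrC.
have J_lin a b : linear (J a b).
  move=> c x y; rewrite /J ![br (c *: x + y) _]brC !(brD, brZ, brN).
  rewrite [br x a]brC [br y a]brC [br x (br a b)]brC [br y (br a b)]brC !brN.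
  by rewrite -!mul_mpolyC; ring.
have J_leib a b x y : J a b (x * y) = J a b x * y + x * J a b y.
  rewrite /J ![br (x * y) _]brC !(brN, br_leib, brD).
  rewrite [br x a]brC [br y a]brC [br x (br a b)]brC [br y (br a b)]brC !brN.
  by ring.
move=> f g h; rewrite -/(J f g h).
move: h; apply: derivation0 => // i; rewrite -JC.
move: g; apply: derivation0 => // j; rewrite -JC.
move: f; apply: derivation0 => // l.
by rewrite /J !br_var !addr0.
Qed.

End Jacobi.

Section StdPoisson.
Variables (k : fieldType) (n : nat).
Local Notation P := {mpoly k[n + n]}.

Definition var_x (i : 'I_n) : P := 'X_(lshift n i).
Definition var_y (i : 'I_n) : P := 'X_(rshift n i).

(* The bracket determined by [{x_i, y_j} = (i == j)] and
   [{x_i, x_j} = {y_i, y_j} = 0], see [std_bracket_xy], [std_bracket_xx] and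
   [std_bracket_yy] below. *)
Definition std_bracket (f g : P) : P :=
  \sum_(i < n) (f^`M(lshift n i) * g^`M(rshift n i)
                - f^`M(rshift n i) * g^`M(lshift n i)).

Fact std_bracket_linl g : linear (std_bracket^~ g).
Proof.
move=> c f1 f2; rewrite /std_bracket scaler_sumr -big_split; apply: eq_bigr => i _.
by rewrite /= !linearP /= !mulrDl -!scalerAl scalerBr opprD addrACA.
Qed.

Fact std_bracket_alt f : std_bracket f f = 0.
Proof. by rewrite /std_bracket big1 // => i _; rewrite mulrC subrr. Qed.

Lemma std_bracketC f g : std_bracket f g = - std_bracket g f.
Proof.
rewrite /std_bracket -sumrN; apply: eq_bigr => i _.
by rewrite opprB mulrC [X in _ - X]mulrC.
Qed.

Fact std_bracket_linr f : linear (std_bracket f).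
Proof.
move=> c g1 g2; rewrite std_bracketC std_bracket_linl opprD -scalerN.
by rewrite -!std_bracketC.
Qed.

Fact std_bracket_leibniz f g1 g2 :
  std_bracket f (g1 * g2) = std_bracket f g1 * g2 + g1 * std_bracket f g2.
Proof.
rewrite /std_bracket mulr_suml mulr_sumr -big_split; apply: eq_bigr => i _ /=.
rewrite !mderivM; ring.
Qed.

Lemma std_bracket_xy i j : std_bracket (var_x i) (var_y j) = (i == j)%:R.
Proof.
rewrite /std_bracket (bigD1 i) //= big1 => [|l l_i]; rewrite !mderiv_var
  !eq_lshift ?eq_rshift !eq_rlshift ?eqxx mul0r subr0 ?(negPf l_i) ?mul0r //.
by rewrite mul1r addr0.
Qed.

Lemma std_bracket_xx i j : std_bracket (var_x i) (var_x j) = 0.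
Proof.
by rewrite /std_bracket big1 // => l _; rewrite !mderiv_var !eq_rlshift mulr0 mul0r subrr.
Qed.

Lemma std_bracket_yy i j : std_bracket (var_y i) (var_y j) = 0.
Proof.
by rewrite /std_bracket big1 // => l _; rewrite !mderiv_var !eq_lrshift mulr0 mul0r subrr.
Qed.

Fact std_bracket_jacobi f g h :
  std_bracket f (std_bracket g h) + std_bracket g (std_bracket h f)
    + std_bracket h (std_bracket f g) = 0.
Proof.
apply: jacobi_var => {f g h}; [exact: std_bracket_linr|exact: std_bracketC|
  exact: std_bracket_leibniz|] => f i j.
have Bc (b : bool) : std_bracket f b%:R = 0.
  rewrite /std_bracket big1 // => l _.
  by rewrite -mpolyC_nat !mderivC !mulr0 subrr.
have B0 : std_bracket f 0 = 0 := Bc false.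
rewrite -(splitK i) -(splitK j); case: (split i) => i'; case: (split j) => j' /=.
- by rewrite std_bracket_xx.
- by rewrite std_bracket_xy.
- rewrite [std_bracket 'X_(rshift _ _) _]std_bracketC std_bracket_xy.
  by rewrite -[- _]addr0 -scaleN1r std_bracket_linr Bc B0 scaler0 addr0.
- by rewrite std_bracket_yy.
Qed.

Definition std_poisson : poisson P :=
  Poisson std_bracket_linl std_bracket_linr std_bracket_alt std_bracket_jacobi
    std_bracket_leibniz.

End StdPoisson.

Arguments var_x {k n} i.
Arguments var_y {k n} i.

(** * Weyl algebras *)

Section Weyl.
Variables (k : fieldType) (n : nat).

(* As for [{mpoly k[n + n]}], the first [n] generators are the [X_i] and the
   last [n] ones the [Y_i]. *)
Let X (i : 'I_n) : freealg k 'I_(n + n) := fgen k (lshift n i).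
Let Y (i : 'I_n) : freealg k 'I_(n + n) := fgen k (rshift n i).

Inductive weyl_rel : freealg k 'I_(n + n) -> freealg k 'I_(n + n) -> Prop :=
| weyl_rel_XY i j : weyl_rel (X i * Y j - Y j * X i) (i == j)%:R
| weyl_rel_XX i j : weyl_rel (X i * X j - X j * X i) 0
| weyl_rel_YY i j : weyl_rel (Y i * Y j - Y j * Y i) 0.

(* [X_i] acts on polynomials by differentiation, [Y_i] by multiplication. *)
Let op (i : 'I_(n + n)) (f : {mpoly k[n]}) : {mpoly k[n]} :=
  match split i with inl j => f^`M(j) | inr j => 'X_j * f end.

Fact weyl_consistent : consistent weyl_rel.
Proof.
have op_lin i : linear (op i).
  rewrite /op; case: (split i) => j c x y; first by rewrite linearP.
  by rewrite mulrDr scalerAr.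
have opX i f : op (lshift n i) f = f^`M(i) by rewrite /op (unsplitK (inl i)).
have opY i f : op (rshift n i) f = 'X_i * f by rewrite /op (unsplitK (inr i)).
apply: (consistent_act op_lin (oner_neq0 {mpoly k[n]})) => u v.
case=> i j x; rewrite ?(freealg_actE op_lin, freealg_actNl op) ?(opX, opY).
- rewrite mderivM mderiv_var addrK; case: eqP => _.
    by rewrite mul1r (freealg_actE op_lin).
  by rewrite mul0r (freealg_actE op_lin).
- by rewrite mderiv_comm subrr.
- by rewrite mulrCA subrr.
Qed.

Definition weyl := quotalg weyl_consistent.
HB.instance Definition _ := GRing.Algebra.on weyl.

Definition weyl_gen (i : 'I_(n + n)) : weyl :=
  quotalg_pi weyl_consistent (fgen k i).
Definition weyl_X (i : 'I_n) : weyl := weyl_gen (lshift n i).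
Definition weyl_Y (i : 'I_n) : weyl := weyl_gen (rshift n i).

Lemma weyl_XY i j : weyl_X i * weyl_Y j - weyl_Y j * weyl_X i = (i == j)%:R.
Proof. by rewrite (quotalg_comm _ (weyl_rel_XY i j)) rmorph_nat. Qed.

Lemma weyl_XX i j : weyl_X i * weyl_X j - weyl_X j * weyl_X i = 0.
Proof. by rewrite (quotalg_comm _ (weyl_rel_XX i j)) rmorph0. Qed.

Lemma weyl_YY i j : weyl_Y i * weyl_Y j - weyl_Y j * weyl_Y i = 0.
Proof. by rewrite (quotalg_comm _ (weyl_rel_YY i j)) rmorph0. Qed.

End Weyl.

(** * Tensor products and enveloping algebras of associative algebras *)

Section ConverseAlg.
Variables (k : fieldType) (A : algType k).

HB.instance Definition _ := GRing.Lmodule.on A^c.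

Fact converse_scaleAl (c : k) (x y : A^c) :
  c *: (x * y) = (c *: x : A^c) * y.
Proof. exact: (@scalerAr k A c y x). Qed.
HB.instance Definition _ := GRing.Lmodule_isLalgebra.Build k A^c converse_scaleAl.

Fact converse_scaleAr (c : k) (x y : A^c) :
  c *: (x * y) = x * (c *: y : A^c).
Proof. exact: (@scalerAl k A c y x). Qed.
HB.instance Definition _ := GRing.Lalgebra_isAlgebra.Build k A^c converse_scaleAr.

End ConverseAlg.

Section Tensor.
Variables (k : fieldType) (A B : algType k).

Definition tensor_idx : choiceType := (A * B)%type.
Let t (a : A) (b : B) : freealg k tensor_idx := fgen k ((a, b) : tensor_idx).

(* Presentation of [A (x) B] by the pure tensors. *)
Inductive tensor_rel : freealg k tensor_idx -> freealg k tensor_idx -> Prop :=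
| tensor_rel_linl c a a' b :
    tensor_rel (t (c *: a + a') b) (c *: t a b + t a' b)
| tensor_rel_linr c a b b' :
    tensor_rel (t a (c *: b + b')) (c *: t a b + t a b')
| tensor_relM a a' b b' : tensor_rel (t (a * a') (b * b')) (t a b * t a' b')
| tensor_rel1 : tensor_rel (t 1 1) 1.

End Tensor.

Section AlgEnv.
Variables (k : fieldType) (A : algType k).

Let op (u : tensor_idx A A^c) (x : A) : A := u.1 * x * (u.2 : A).

(* [A] is a module over [A (x) A^op], by left and right multiplications. *)
Fact alg_env_consistent : consistent (tensor_rel (A := A) (B := A^c)).
Proof.
have op_lin u : linear (op u).
  by move=> c x y; rewrite /op mulrDr mulrDl -scalerAr -scalerAl.
apply: (consistent_act op_lin (oner_neq0 A)) => u v.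
case=> [c a a' b|c a b b'|a a' b b'|] x;
  rewrite ?(freealg_actE op_lin) /op /=.
- by rewrite !mulrDl -!scalerAl.
- by rewrite mulrDr scalerAr.
- by rewrite -[(b * b' : A)]/((b' : A) * (b : A)) !mulrA.
- by rewrite mul1r mulr1.
Qed.

Definition alg_env := quotalg alg_env_consistent.
HB.instance Definition _ := GRing.Algebra.on alg_env.

(* [a (x) b]; the canonical anti-isomorphism [A -> A^op] is the identity map
   [A -> A^c]. *)
Definition alg_tens (a : A) (b : A^c) : alg_env :=
  quotalg_pi alg_env_consistent (fgen k ((a, b) : tensor_idx A A^c)).

Let rel u v : tensor_rel u v ->
  quotalg_pi alg_env_consistent u = quotalg_pi alg_env_consistent v.
Proof. exact: quotalg_rel. Qed.

Lemma alg_tens_linl (c : k) (a a' : A) (b : A^c) :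
  alg_tens (c *: a + a') b = c *: alg_tens a b + alg_tens a' b.
Proof.
rewrite /alg_tens (rel (@tensor_rel_linl k A A^c c a a' b)); exact: linearP.
Qed.

Lemma alg_tens_linr (c : k) (a : A) (b b' : A^c) :
  alg_tens a (c *: b + b' : A^c) = c *: alg_tens a b + alg_tens a b'.
Proof.
rewrite /alg_tens (rel (@tensor_rel_linr k A A^c c a b b')); exact: linearP.
Qed.

Lemma alg_tensM (a a' : A) (b b' : A^c) :
  alg_tens (a * a') (b * b') = alg_tens a b * alg_tens a' b'.
Proof.
rewrite /alg_tens (rel (@tensor_relM k A A^c a a' b b')); exact: rmorphM.
Qed.

Lemma alg_tens1 : alg_tens 1 1 = 1.
Proof. by rewrite /alg_tens (rel (@tensor_rel1 k A A^c)) rmorph1. Qed.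

End AlgEnv.

(** * Symmetrization and star products *)

Section Star.
Variables (k : fieldType) (n : nat).
Local Notation P := {mpoly k[n + n]}.

(* The linear form of [P_n] with coordinates [l], and the corresponding element
   of the Weyl algebra. *)
Definition lin_form (l : 'rV[k]_(n + n)) : P := \sum_i l 0 i *: 'X_i.
Definition weyl_form (l : 'rV[k]_(n + n)) : weyl k n :=
  \sum_i l 0 i *: weyl_gen k i.

(* [weyl k n] is not commutative: the product over [i < p] is taken in
   increasing order of [i]. *)
Definition is_symmetrization (w : {linear P -> weyl k n}) : Prop :=
  forall p (l : 'I_p -> 'rV[k]_(n + n)),
    w (\prod_(i < p) lin_form (l i)) =
    (p`!)%:R^-1 *: \sum_(s : 'S_p) \prod_(i < p) weyl_form (l (s i)).

Definition is_theta
    (theta : {lrmorphism alg_env (weyl k n) -> poisson_env (std_poisson k n)}) :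
    Prop :=
  forall i : 'I_n,
  [/\ theta (alg_tens (weyl_X k i) 1)
        = poisson_env_m _ (var_x i) + 2%:R^-1 *: poisson_env_h _ (var_x i),
      theta (alg_tens 1 (weyl_X k i))
        = poisson_env_m _ (var_x i) - 2%:R^-1 *: poisson_env_h _ (var_x i),
      theta (alg_tens (weyl_Y k i) 1)
        = poisson_env_m _ (var_y i) + 2%:R^-1 *: poisson_env_h _ (var_y i) &
      theta (alg_tens 1 (weyl_Y k i))
        = poisson_env_m _ (var_y i) - 2%:R^-1 *: poisson_env_h _ (var_y i)].

(* [rho^-1 (rho f * rho g)]; [0] if [rho f * rho g] is not in the image. *)
Definition star (A : algType k) (rho : P -> A) (f g : P) : P :=
  xget 0 [set r | rho r = rho f * rho g].

(* For [a = (a1, a2)]: [|a2|], [a!] and [a^* = (a2, a1)]. *)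
Definition mdeg2 (a : 'X_{1..n + n}) : nat := (\sum_(i < n) a (rshift n i))%N.
Definition mfact (a : 'X_{1..n + n}) : nat := (\prod_(i < n + n) (a i)`!)%N.
Definition mswap (a : 'X_{1..n + n}) : 'X_{1..n + n} :=
  [multinom match split i with
            | inl j => a (rshift n j)
            | inr j => a (lshift n j)
            end | i < n + n].

End Star.

(* Main.v *)
(** The maps [theta] and [a |-> a (x) 1] are injective algebra morphisms, so the
claim amounts to [w (moyal f g) = w f * w g]. Left Moyal multiplication by a
variable [x] is [f |-> x f + {x, f} / 2]. On a power [l ^+ p] of a linear form,
the identity [w (x f + {x, f} / 2) = X * w f] is the coefficient of [t] in
[w ((t x + l) ^+ p.+1) = (t X + L) ^+ p.+1]; in characteristic [0] it extends to
all [f], as powers of linear forms span the polynomials. Since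
[moyal (x f) g = x (moyal f g) + moyal f ({x, g} / 2)] and [{x, -}] is a derivation
of the Moyal product, the claim follows by induction on [f]. *)

Require Import Defs.
From HB Require Import structures.
From mathcomp Require Import all_boot all_order all_fingroup all_algebra.
From mathcomp Require Import boolp classical_sets fsbigop.
From mathcomp Require Import ring.
From mathcomp Require Import mpoly.

Set Implicit Arguments.
Unset Strict Implicit.
Unset Printing Implicit Defensive.

Import GRing.Theory.
Local Open Scope ring_scope.

(** * Coefficient extraction in characteristic 0 and powers of linear forms *)

Lemma natf_neq0_char0 (k : fieldType) (k_char0 : [pchar k] =i pred0) m :
  (m.+1%:R : k) != 0.
Proof. by have /pcharf0P -> := k_char0. Qed.

(** The nodes 0, ..., N-1 are distinct in characteristic 0, so their Vandermonde matrix is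
    invertible and column [j] of the inverse provides the weights. They are chosen before [V] and
    [c], so that the same weights serve for polynomials and for the Weyl algebra. *)
Lemma interpolation (k : fieldType) (k_char0 : [pchar k] =i pred0) (N j : nat) :
    (j < N)%N ->
  exists a : 'I_N -> k, forall (V : lmodType k) (c : nat -> V),
    \sum_(m < N) a m *: (\sum_(i < N) (m%:R ^+ i : k) *: c i) = c j.
Proof.
move=> ltjN; pose V := @Vandermonde k N N (\row_m m%:R).
have Vu : V \in unitmx.
  rewrite unitmxE det_Vandermonde unitfE; apply/prodf_neq0 => i _.
  apply/prodf_neq0 => l ltil; rewrite !mxE -natrB 1?ltnW //.
  by rewrite -(prednK (_ : 0 < l - i)%N) ?subn_gt0 // natf_neq0_char0.
exists (fun m => invmx V m (Ordinal ltjN)) => W c.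
under eq_bigr do rewrite scaler_sumr.
rewrite exchange_big /= (bigD1 (Ordinal ltjN)) //= [X in _ + X]big1 => [|i ij].
- under eq_bigr do rewrite scalerA; rewrite -scaler_suml.
  suff -> : \sum_m invmx V m (Ordinal ltjN) * m%:R ^+ j = 1.
    by rewrite scale1r addr0.
  have := congr1 (fun M : 'M_N => M (Ordinal ltjN) (Ordinal ltjN)) (mulmxV Vu).
  rewrite !mxE eqxx => e; rewrite -[RHS]/(true%:R) -e; apply: eq_bigr => m _.
  by rewrite [RHS]mulrC !mxE.
- under eq_bigr do rewrite scalerA; rewrite -scaler_suml.
  suff -> : \sum_m invmx V m (Ordinal ltjN) * m%:R ^+ i = 0 by rewrite scale0r.
  have := congr1 (fun M : 'M_N => M i (Ordinal ltjN)) (mulmxV Vu).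
  rewrite !mxE (negPf ij) => e; rewrite -[RHS]/(false%:R) -e; apply: eq_bigr => m _.
  by rewrite [RHS]mulrC !mxE.
Qed.

(** Moving [x] to the front of [l ^+ i * x * l ^+ (p - i)] costs [i] times [c *: l ^+ p.-1]; summing
    over [i <= p] gives the binomial coefficient. It is 0 for [p = 0], where [p.-1] is truncated. *)
Lemma pencil_exp (k : fieldType) (A : algType k) (x l : A) (c : k) (p : nat) :
    x * l - l * x = c%:A ->
  exists2 e : nat -> A,
    forall t : k, (t *: x + l) ^+ p.+1 = \sum_(i < p.+2) t ^+ i *: e i &
    e 1 = (p.+1%:R *: (x * l ^+ p) - ('C(p.+1, 2)%:R * c) *: l ^+ p.-1).
Proof.
(* The induction also tracks [e 0], because the next linear coefficient is [x * e 0 + l * e 1]. *)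
move=> xl; suff [e [eE e0 e1]] : exists e : nat -> A,
    [/\ forall t : k, (t *: x + l) ^+ p.+1 = \sum_(i < p.+2) t ^+ i *: e i,
    e 0 = l ^+ p.+1 &
    e 1 = (p.+1%:R *: (x * l ^+ p) - ('C(p.+1, 2)%:R * c) *: l ^+ p.-1)].
  by exists e.
elim: p => [|p [e [eE e0 e1]]].
  exists (fun i => if i == 0 then l else x); split=> // [t|].
    by rewrite expr1 !big_ord_recr big_ord0 /= add0r expr0 scale1r expr1 addrC.
  by rewrite expr0 mulr1 scale1r mul0r scale0r subr0.
(* The guard drops [e p.+2], about which the induction hypothesis says nothing. *)
exists (fun i => (if i is i'.+1 then x * e i' else 0)
  + (if (i < p.+2)%N then l * e i else 0)); split.
- move=> t; rewrite exprS eE mulrDl.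
  under [RHS]eq_bigr do rewrite scalerDr.
  rewrite big_split /=; congr (_ + _).
    rewrite [RHS]big_ord_recl /= scaler0 add0r mulr_sumr; apply: eq_bigr => i _.
    by rewrite -scalerAl -scalerAr scalerA exprS.
  rewrite [RHS]big_ord_recr /= ltnn scaler0 addr0 mulr_sumr.
  by apply: eq_bigr => i _; rewrite ltn_ord scalerAr.
- by rewrite /= e0 add0r -exprS.
- have lx : l * x = x * l - c%:A by rewrite -xl subKr.
  rewrite /= e0 e1 mulrBr -!scalerAr mulrA lx mulrBl -mulrA -exprS scalerBr.
  rewrite mulr_algl scalerA addrA addrA.
  have -> : ('C(p.+1, 2)%:R * c) *: (l * l ^+ p.-1) = ('C(p.+1, 2)%:R * c) *: l ^+ p.
    by case: p {e eE e0 e1} => [|p]; rewrite ?mul0r ?scale0r // -exprS.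
  rewrite -addrA -opprD -scalerDl -mulrDl -natrD [in RHS]binS bin1 addnC.
  by rewrite -{1}[x * _]scale1r -scalerDl nat1r.
Qed.

Lemma mpoly_var_ind (k : fieldType) N (Q : {mpoly k[N]} -> Prop) :
    (forall c f g, Q f -> Q g -> Q (c *: f + g)) -> Q 1 ->
    (forall i f, Q f -> Q ('X_i * f)) -> forall f, Q f.
Proof.
move=> Qlin Q1 QX.
have Q0 : Q 0 by rewrite -(addNr 1) -scaleN1r; apply: Qlin.
elim/mpolyind => // c m f _ _ Qf; apply: Qlin => //; rewrite mpolyXE_id.
elim: (index_enum _) => [|i s Qs]; first by rewrite big_nil.
rewrite big_cons; elim: (m i) => [|r]; first by rewrite expr0 mul1r.
by rewrite exprS -mulrA; apply: QX.
Qed.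

Lemma lin_formE (k : fieldType) n (i : 'I_(n + n)) (c : k) l :
  lin_form (c *: delta_mx 0 i + l) = c *: 'X_i + lin_form l.
Proof.
rewrite /lin_form; under eq_bigr do rewrite !mxE scalerDl.
rewrite big_split (bigD1 i) //= !eqxx mulr1 big1 ?addr0 // => j /negPf ji.
by rewrite ji mulr0 scale0r.
Qed.

Lemma weyl_formE (k : fieldType) n (i : 'I_(n + n)) (c : k) l :
  weyl_form (c *: delta_mx 0 i + l) = c *: weyl_gen k i + weyl_form l.
Proof.
rewrite /weyl_form; under eq_bigr do rewrite !mxE scalerDl.
rewrite big_split (bigD1 i) //= !eqxx mulr1 big1 ?addr0 // => j /negPf ji.
by rewrite ji mulr0 scale0r.
Qed.

(** Polarization: up to the factor [p.+1], the product ['X_i * lin_form l ^+ p] is the coefficient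
    of [t] in the power [p.+1] of [t *: 'X_i + lin_form l]. By [interpolation] it is a combination
    of values at integers [t], which are again powers of linear forms. *)
Lemma lin_form_exp_ind (k : fieldType) (k_char0 : [pchar k] =i pred0) n
    (Q : {mpoly k[n + n]} -> Prop) :
    (forall c f g, Q f -> Q g -> Q (c *: f + g)) ->
    (forall l p, Q (lin_form l ^+ p)) -> forall f, Q f.
Proof.
move=> Qlin Qpow f.
(* [S] is the span of the powers of linear forms. *)
pose S f := forall Q : {mpoly k[n + n]} -> Prop,
  (forall c f g, Q f -> Q g -> Q (c *: f + g)) ->
  (forall l p, Q (lin_form l ^+ p)) -> Q f.
suff Sf : S f by apply: Sf.
elim/mpoly_var_ind: f {Qlin Qpow Q} => [c f g Sf Sg Q Qlin Qpow|Q _ Qpow|i f Sf].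
- exact: (Qlin _ _ _ (Sf Q Qlin Qpow) (Sg Q Qlin Qpow)).
- by rewrite -(expr0 (lin_form 0)); apply: Qpow.
(* Using [Sf] with a predicate built from [S] itself leaves only the case of a power of a linear
   form. *)
apply: (Sf (fun f => S ('X_i * f))) => [c g h Sg Sh Q Qlin Qpow|l p Q Qlin Qpow].
  by rewrite mulrDr -scalerAr; exact: (Qlin _ _ _ (Sg Q Qlin Qpow) (Sh Q Qlin Qpow)).
have xl : 'X_i * lin_form l - lin_form l * 'X_i = 0%:A :> {mpoly k[n + n]}.
  by rewrite scale0r mulrC subrr.
have [e eE e1] := pencil_exp p xl.
have [a aE] := interpolation k_char0 (isT : (1 < p.+2)%N).
have Q0 : Q 0 by rewrite -(addNr (lin_form 0 ^+ 0)) -scaleN1r; apply: Qlin.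
have QZ c g : Q g -> Q (c *: g) by move=> Qg; rewrite -[_ *: _]addr0; apply: Qlin.
have -> : 'X_i * lin_form l ^+ p = p.+1%:R^-1 *: e 1%N.
  by rewrite e1 mulr0 scale0r subr0 scalerA mulVf ?scale1r ?natf_neq0_char0.
apply: (QZ); rewrite -aE; apply: big_ind => // [g h Qg Qh|m _].
  by rewrite -[g]scale1r; apply: Qlin.
by apply: QZ; rewrite -eE -lin_formE.
Qed.

(** * Conjugate variables, commutators and half brackets *)

Definition dual n (i : 'I_(n + n)) : 'I_(n + n) :=
  match split i with inl j => rshift n j | inr j => lshift n j end.

(** The Poisson bracket of the variable of index [i] with its conjugate, the variable of index
    [dual i]. *)
Definition dual_sign (k : fieldType) n (i : 'I_(n + n)) : k :=
  if split i is inl _ then 1 else -1.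

(* Left Moyal multiplication by the variable of index [i] is multiplication plus
   [hderiv i], half of the bracket with that variable. *)
Definition hderiv (k : fieldType) n (i : 'I_(n + n)) (f : {mpoly k[n + n]}) :=
  (dual_sign k i / 2%:R) *: f^`M(dual i).

Lemma split_lshift m n (i : 'I_m) : split (lshift n i) = inl i.
Proof. exact: (unsplitK (inl i)). Qed.

Lemma split_rshift m n (i : 'I_n) : split (rshift m i) = inr i.
Proof. exact: (unsplitK (inr i)). Qed.

Lemma weyl_gen_comm (k : fieldType) n (i j : 'I_(n + n)) :
  weyl_gen k i * weyl_gen k j - weyl_gen k j * weyl_gen k i
  = (dual_sign k i *+ (j == dual i))%:A.
Proof.
rewrite /dual /dual_sign.
case: (split_ordP i) => i' ->; case: (split_ordP j) => j' ->;
  rewrite ?split_lshift ?split_rshift ?eq_lrshift ?eq_rlshift ?eq_lshift ?eq_rshift.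
- by rewrite scale0r; apply: weyl_XX.
- rewrite eq_sym; apply: etrans (weyl_XY k i' j') _; case: eqP; by rewrite ?scale1r ?scale0r.
- rewrite -opprB; apply: (etrans (congr1 -%R (weyl_XY k j' i'))).
  by case: eqP; rewrite ?scaleN1r ?scale0r ?oppr0.
- by rewrite scale0r; apply: weyl_YY.
Qed.

(** Only the conjugate generator contributes, so the commutator is a scalar, as [pencil_exp]
    requires. *)
Lemma weyl_gen_form (k : fieldType) n (i : 'I_(n + n)) (l : 'rV[k]_(n + n)) :
  weyl_gen k i * weyl_form l - weyl_form l * weyl_gen k i
  = (dual_sign k i * l 0 (dual i))%:A.
Proof.
rewrite /weyl_form mulr_sumr mulr_suml -sumrB (bigD1 (dual i)) //= big1 => [|j ji].
  by rewrite -scalerAl -scalerAr -scalerBr weyl_gen_comm eqxx addr0 scalerA mulrC.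
by rewrite -scalerAl -scalerAr -scalerBr weyl_gen_comm (negPf ji) scale0r scaler0.
Qed.

Lemma mderiv_exp (k : fieldType) N (j : 'I_N) (f : {mpoly k[N]}) p :
  (f ^+ p)^`M(j) = p%:R *: (f ^+ p.-1 * f^`M(j)).
Proof.
elim: p => [|p IHp]; first by rewrite scale0r expr0 -mpolyC1 mderivC.
rewrite exprS mderivM IHp -scalerAr mulrA -nat1r scalerDl scale1r mulrC.
by case: p {IHp} => [|p]; rewrite ?scale0r //= -exprS.
Qed.

Lemma mderiv_lin_form (k : fieldType) n (j : 'I_(n + n)) (l : 'rV[k]_(n + n)) :
  (lin_form l)^`M(j) = (l 0 j)%:A.
Proof.
rewrite /lin_form linear_sum (bigD1 j) //= big1 => [|i ij]; rewrite mderivZ mderiv_var.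
  by rewrite eqxx addr0.
by rewrite eq_sym (negPf ij) scaler0.
Qed.

Lemma hderiv_lin (k : fieldType) n (i : 'I_(n + n)) : linear (@hderiv k n i).
Proof.
by move=> c f g; rewrite /hderiv mderivD mderivZ scalerDr !scalerA mulrC.
Qed.

HB.instance Definition _ (k : fieldType) n (i : 'I_(n + n)) :=
  GRing.isLinear.Build k {mpoly k[n + n]} {mpoly k[n + n]} *:%R (@hderiv k n i)
    (hderiv_lin i).

Lemma hderivM (k : fieldType) n (i : 'I_(n + n)) (f g : {mpoly k[n + n]}) :
  hderiv i (f * g) = hderiv i f * g + f * hderiv i g.
Proof. by rewrite /hderiv mderivM scalerDr scalerAl scalerAr. Qed.

Lemma hderiv_mderivm (k : fieldType) n (i : 'I_(n + n)) a (f : {mpoly k[n + n]}) :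
  hderiv i f^`M[a] = (hderiv i f)^`M[a].
Proof.
by rewrite /hderiv mderivmZ -2!mderivmU1m -!mderivmDm addmC.
Qed.

(** * Symmetrization and left multiplication by a generator *)

Section Symmetrization.
Variables (k : fieldType) (k_char0 : [pchar k] =i pred0) (n : nat).
Variable w : {linear {mpoly k[n + n]} -> weyl k n}.
Hypothesis wP : is_symmetrization w.

(** For equal linear forms the [p]! terms of the average coincide. *)
Lemma symmetrization_exp l p : w (lin_form l ^+ p) = weyl_form l ^+ p.
Proof.
have := wP (fun _ : 'I_p => l); rewrite prodr_const card_ord => ->.
rewrite (eq_bigr (fun=> weyl_form l ^+ p)) => [|s _]; last first.
  by rewrite prodr_const card_ord.
rewrite sumr_const card_Sn -scaler_nat scalerA mulVf ?scale1r //.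
by rewrite -(prednK (fact_gt0 p)) natf_neq0_char0.
Qed.

Lemma symmetrization1 : w 1 = 1.
Proof. by rewrite -(expr0 (lin_form 0)) symmetrization_exp. Qed.

(* On a power [l ^+ p], compare the terms linear in [t] of the two sides of
   [w ((t x + l) ^+ p.+1) = (t X + L) ^+ p.+1]. *)
Lemma symmetrization_var i f :
  w ('X_i * f + hderiv i f) = weyl_gen k i * w f.
Proof.
elim/(lin_form_exp_ind k_char0): f => [c f g IHf IHg|l p].
  rewrite hderiv_lin mulrDr -scalerAr addrACA -scalerDr !linearP IHf IHg.
  by rewrite mulrDr -scalerAr.
have xl : 'X_i * lin_form l - lin_form l * 'X_i = 0%:A :> {mpoly k[n + n]}.
  by rewrite scale0r mulrC subrr.
have [e eE e1] := pencil_exp p xl.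
have [e' e'E e'1] := pencil_exp p (weyl_gen_form i l).
have [a aE] := interpolation k_char0 (isT : (1 < p.+2)%N).
(* The same weights extract both coefficients, and [w] is linear. *)
have we : w (e 1%N) = e' 1%N.
  rewrite -!aE linear_sum; apply: eq_bigr => m _.
  by rewrite linearZ /= -eE -e'E -lin_formE symmetrization_exp weyl_formE.
have nz := natf_neq0_char0 k_char0.
move: we; rewrite e1 e'1 mulr0 scale0r subr0 linearZ /= => we.
apply: (scalerI (nz p)); rewrite linearD scalerDr we symmetrization_exp.
rewrite -addrA -[RHS]addr0; congr (_ + _).
rewrite /hderiv mderiv_exp mderiv_lin_form mulr_algr !scalerA [w (_ *: _)]linearZ /=.
rewrite symmetrization_exp scalerA addrC -scalerBl.
suff -> : p.+1%:R * (dual_sign k i / 2%:R * p%:R * l 0 (dual i))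
    - 'C(p.+1, 2)%:R * (dual_sign k i * l 0 (dual i)) = 0 by rewrite scale0r.
(* This is where the factor 1/2 in [hderiv] matches the reordering cost in the Weyl algebra. *)
have -> : 'C(p.+1, 2)%:R = p.+1%:R * p%:R / 2%:R :> k.
  by rewrite -natrM -[X in (_ * X)%N]bin1 (mul_bin_diag p.+1 1) natrM mulrC mulKf ?nz.
by ring.
Qed.

End Symmetrization.

(** * Sums over multi-indices and iterated derivatives *)

Lemma fsbig_mdeg (k : fieldType) N (V : lmodType k) (F : 'X_{1..N} -> V) d :
    (forall a, (d <= mdeg a)%N -> F a = 0) ->
  \sum_(a \in [set: 'X_{1..N}]) F a = \sum_(a : 'X_{1..N < d}) F a.
Proof.
move=> F0; rewrite (fsbigE (map val (enum {: 'X_{1..N < d}}))) //.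
- by rewrite big_map big_enum_cond; apply: eq_bigl => a; rewrite in_setT.
- by rewrite (map_inj_uniq val_inj) enum_uniq.
move=> a _ a_notin; apply: F0; rewrite leqNgt; apply: contra a_notin => lt_ad.
by apply/mapP; exists (BMultinom lt_ad) => //; rewrite mem_enum.
Qed.

(** Each monomial of [f] has degree below that of [a], hence some exponent smaller than that of [a],
    and the corresponding falling factorial vanishes. *)
Lemma mderivm_eq0 (k : fieldType) N (f : {mpoly k[N]}) a :
  (msize f <= mdeg a)%N -> f^`M[a] = 0.
Proof.
move=> le_fa; rewrite mderivmE big_seq big1 // => m /msize_mdeg_lt lt_mf.
have [j lt_j] : exists j, (m j < a j)%N.
  apply/existsP; apply: contraLR (leq_trans lt_mf le_fa).
  rewrite negb_exists => /forallP le_am; rewrite -leqNgt !mdegE.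
  by apply: leq_sum => j _; rewrite leqNgt.
by rewrite (bigD1 j) //= ffact_small // mul0n mulr0 scale0r.
Qed.

(** Leibniz rule with a factor of degree 1, by peeling off one derivative at a time. When [a i] is 0
    the subtraction is truncated, but its coefficient is 0. *)
Lemma mderivm_var (k : fieldType) N (f : {mpoly k[N]}) i a :
  ('X_i * f)^`M[a] = 'X_i * f^`M[a] + (a i)%:R *: f^`M[a - U_(i)].
Proof.
move Ed: (mdeg a) => d; elim: d a Ed => [|d IHd] a Ed.
  have -> : a = 0%MM by apply/eqP; rewrite -mdeg_eq0 Ed.
  by rewrite !mderivm0m mnm0E scale0r addr0.
have [j aj] : exists j, (a j != 0)%N.
  apply/existsP; apply: contra_eqT Ed; rewrite negb_exists => /forallP a0.
  by rewrite mdegE big1 // => j _; apply/eqP; rewrite -[_ == _]negbK.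
have {aj} : (U_(j) <= a)%MM by rewrite lep1mP.
move=> /submK; move: (a - U_(j))%MM => b Ea.
have Eb : mdeg b = d by move: Ed; rewrite -Ea mdegD mdeg1 addn1 => -[].
rewrite -Ea !mderivmDm !mderivmU1m IHd // mderivD mderivM mderiv_var mderivZ.
rewrite -[f^`M[_]^`M(j) in X in _ + X = _]mderivmU1m -mderivmDm.
rewrite addrAC addrC; congr (_ + _); rewrite mnmDE mnm1E.
have [->|ji] := eqVneq j i.
  rewrite mul1r addmK natrD scalerDl scale1r addrC; congr (_ + _).
  have [->|bi] := eqVneq (b i) 0%N; first by rewrite !scale0r.
  by rewrite submK // lep1mP.
rewrite mul0r add0r addn0.
have [->|bi] := eqVneq (b i) 0%N; first by rewrite !scale0r.
congr (_ *: _^`M[_]); apply/mnmP => l; rewrite !(mnmDE, mnmBE, mnm1E).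
by rewrite addnBAC //; case: (i =P l) => [<-|//]; rewrite lt0n.
Qed.

(** * The Moyal product and its compatibility with symmetrization *)

Section Moyal.
Variables (k : fieldType) (k_char0 : [pchar k] =i pred0) (n : nat).
Local Notation P := {mpoly k[n + n]}.

Definition moyal_coef (a : 'X_{1..n + n}) : k :=
  (-1) ^+ mdeg2 a / ((mfact a)%:R * 2%:R ^+ mdeg a).

Definition moyal (f g : P) : P :=
  \sum_(a \in [set: 'X_{1..n + n}]) moyal_coef a *: (f^`M[a] * g^`M[mswap a]).

(** The bound [d] is left free so that sums for different [f] can share an index set. *)
Lemma moyalE d f g : (msize f <= d)%N ->
  moyal f g =
  \sum_(a : 'X_{1..(n + n) < d}) moyal_coef a *: (f^`M[a] * g^`M[mswap a]).
Proof.
move=> le_fd; apply: (@fsbig_mdeg k _ P) => a /(leq_trans le_fd) /mderivm_eq0 ->.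
by rewrite mul0r scaler0.
Qed.

Lemma moyal_linl g : linear (moyal^~ g).
Proof.
move=> c f1 f2; pose d := maxn (msize (c *: f1 + f2)) (maxn (msize f1) (msize f2)).
rewrite !(@moyalE d) ?leq_max ?leqnn ?orbT // scaler_sumr -big_split /=.
by apply: eq_bigr => a _; rewrite linearP mulrDl scalerDr -scalerAl !scalerA mulrC.
Qed.

Lemma moyal_linr f : linear (moyal f).
Proof.
move=> c g1 g2; rewrite !(@moyalE (msize f)) // scaler_sumr -big_split /=.
by apply: eq_bigr => a _; rewrite linearP mulrDr scalerDr -scalerAr !scalerA mulrC.
Qed.

Lemma hderiv_moyal i f g :
  hderiv i (moyal f g) = moyal (hderiv i f) g + moyal f (hderiv i g).
Proof.
pose d := maxn (msize f) (msize (hderiv i f)).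
rewrite !(@moyalE d) ?leq_max ?leqnn ?orbT // linear_sum -big_split /=.
by apply: eq_bigr => a _; rewrite linearZ /= hderivM !hderiv_mderivm scalerDr.
Qed.

Lemma mswapD1 (b : 'X_{1..n + n}) i : mswap (b + U_(i)) = (mswap b + U_(dual i))%MM.
Proof.
apply/mnmP => j; rewrite mnmDE !mnmE /dual.
case: (split_ordP i) => i' ->; case: (split_ordP j) => j' ->;
  by rewrite ?split_lshift ?split_rshift !mnmE ?eq_lrshift ?eq_rlshift
       ?eq_lshift ?eq_rshift.
Qed.

Lemma mdeg2D1 (b : 'X_{1..n + n}) i :
  mdeg2 (b + U_(i)) = (mdeg2 b + (if split i is inl _ then 0 else 1))%N.
Proof.
rewrite /mdeg2; under eq_bigr do rewrite mnmDE mnm1E; rewrite big_split /=; congr addn.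
case: (split_ordP i) => i' ->; rewrite ?split_lshift ?split_rshift.
  by rewrite big1 // => j _; rewrite eq_lrshift.
rewrite (bigD1 i') //= eqxx big1 ?addn0 // => j ji.
by rewrite eq_rshift eq_sym (negPf ji).
Qed.

Lemma mfactD1 (b : 'X_{1..n + n}) i : mfact (b + U_(i)) = (mfact b * (b i).+1)%N.
Proof.
rewrite /mfact (bigD1 i) //= [in RHS](bigD1 i) //= mnmDE mnm1E eqxx addn1 factS.
rewrite [RHS]mulnAC [(_`! * _)%N]mulnC; congr muln.
by apply: eq_bigr => j ji; rewrite mnmDE mnm1E eq_sym (negPf ji) addn0.
Qed.

(** Raising exponent [i] multiplies the factorial by [(b i).+1], the power of 2 by 2 and the sign by
    [dual_sign k i]; the resulting factor is the one in [hderiv i]. *)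
Lemma moyal_coefD1 (b : 'X_{1..n + n}) i :
  moyal_coef (b + U_(i)) * (b i).+1%:R = moyal_coef b * (dual_sign k i / 2%:R).
Proof.
have nz := natf_neq0_char0 k_char0.
have fact_nz : (mfact b)%:R != 0 :> k.
  rewrite -(prednK (_ : 0 < mfact b)%N) // /mfact.
  by apply: prodn_gt0 => j; apply: fact_gt0.
have pow_nz : 2%:R ^+ mdeg b != 0 :> k by rewrite expf_neq0 ?nz.
rewrite /moyal_coef mdegD mdeg1 mdeg2D1 mfactD1 exprD natrM addn1 exprS /dual_sign.
by case: (split i) => _; rewrite ?expr0 ?expr1; field;
  rewrite fact_nz pow_nz nat1r !nz.
Qed.

Lemma moyal_var i f g :
  moyal ('X_i * f) g = 'X_i * moyal f g + moyal f (hderiv i g).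
Proof.
pose d := maxn (msize f) (msize ('X_i * f)).
have [le_fd le_xfd] : (msize f <= d /\ msize ('X_i * f) <= d.+1)%N.
  by split; rewrite /d ?leq_max ?leqnn // leqW // leq_max leqnn orbT.
(* Beyond the cut-off [d.+1], even [a - U_(i)] has degree at least [msize f], so the lowered
   derivatives vanish too. *)
rewrite (moyalE _ le_xfd) (@moyalE d.+1 f g) 1?leqW //.
under eq_bigr do rewrite mderivm_var mulrDl scalerDr.
rewrite big_split mulr_sumr; congr (_ + _).
  by apply: eq_bigr => a _; rewrite -scalerAr mulrA.
pose F a := moyal_coef a *: ((a i)%:R *: f^`M[a - U_(i)] * g^`M[mswap a]).
transitivity (\sum_(a \in [set: 'X_{1..n + n}]) F a).
  apply/esym/(@fsbig_mdeg k _ P) => a le_da; rewrite /F.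
  have [->|ai] := eqVneq (a i) 0%N; first by rewrite scale0r mul0r scaler0.
  rewrite mderivm_eq0 ?scaler0 ?mul0r ?scaler0 // (leq_trans le_fd) //.
  by rewrite -ltnS -[X in (_ < X)%N]addn1 -(mdeg1 i) -mdegD submK ?lep1mP.
(* The indices with [a i] nonzero are exactly the [b + U_(i)], which turns the lowered terms into
   [moyal f (hderiv i g)]. *)
rewrite -(@fsbig_widen _ _ _ _ [set a : 'X_{1..n + n} | a i != 0%N]%classic [set: _]%classic F) //; last first.
  by move=> a [_ /= /negP/negPn/eqP ai]; rewrite /F ai scale0r mul0r scaler0.
rewrite (@reindex_fsbig _ _ _ _ _ (fun b => b + U_(i))%MM [set: _]%classic).
  apply: eq_fsbigr => b _; rewrite /F addmK mnmDE mnm1E eqxx addn1.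
  rewrite -scalerAl scalerA moyal_coefD1 mswapD1 addmC mderivmDm mderivmU1m.
  by rewrite /hderiv mderivmZ -scalerAr scalerA.
split=> [b _|b c _ _ /addIm //|a /= ai].
  by rewrite /= mnmDE mnm1E eqxx addn1.
by exists (a - U_(i))%MM => //; rewrite submK ?lep1mP.
Qed.

Lemma moyal1 g : moyal 1 g = g.
Proof.
rewrite /moyal (fsbigE [:: 0%MM]) // => [|a _ /=]; last first.
  rewrite inE -mdeg_eq0 -lt0n => a_gt0.
  by rewrite mderivm_eq0 ?msize1 // mul0r scaler0.
rewrite big_cons big_nil in_setT /= addr0.
have -> : mswap 0 = 0%MM :> 'X_{1..n + n}.
  by apply/mnmP => j; rewrite mnmE; case: (split j) => l; rewrite !mnm0E.
rewrite !mderivm0m mul1r /moyal_coef mdeg0 /mdeg2 /mfact big1 => [|l _]; last exact: mnm0E.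
by rewrite big1 => [|l _]; rewrite ?mnm0E // !expr0 mulr1 divr1 scale1r.
Qed.

Lemma symmetrization_moyal (w : {linear P -> weyl k n}) :
  is_symmetrization w -> forall f g, w (moyal f g) = w f * w g.
Proof.
(* The claim is strengthened to all derivatives of [f]: the step for ['X_i * f] needs it for
   [hderiv i] of a derivative of [f]. *)
move=> wP f g; rewrite -(mderivm0m f); move: 0%MM g.
have lin c (f1 f2 : P) : (forall g, w (moyal f1 g) = w f1 * w g) ->
    (forall g, w (moyal f2 g) = w f2 * w g) ->
    forall g, w (moyal (c *: f1 + f2) g) = w (c *: f1 + f2) * w g.
  by move=> E1 E2 g; rewrite moyal_linl !linearP mulrDl -scalerAl E1 E2.
have moyal0 g : w (moyal 0 g) = w 0 * w g.
  have := moyal_linl g (-1) 0 0.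
  by rewrite /= scaler0 addr0 scaleN1r addNr => ->; rewrite linear0 mul0r.
elim/mpoly_var_ind: f => [c f1 f2 IH1 IH2||i f IHf] b.
- by rewrite linearP; apply: lin; [apply: IH1|apply: IH2].
- have [->|b_neq0] := eqVneq b 0%MM.
    by move=> g; rewrite mderivm0m moyal1 (symmetrization1 k_char0) // mul1r.
  by rewrite mderivm_eq0 // msize1 lt0n mdeg_eq0.
rewrite mderivm_var addrC; apply: (lin); first exact: IHf.
move=> g; set h := f^`M[b].
have IHD : w (moyal (hderiv i h) g) = w (hderiv i h) * w g.
  rewrite -[hderiv i h]addr0; apply: lin => // {}g.
  by rewrite -mderivmU1m -mderivmDm IHf.
(* The added term completes both sides to the shape ['X_i * u + hderiv i u], with [u] equal to
   [moyal h g] on the left and to [h] on the right, where [symmetrization_var] applies. *)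
apply: (addIr (w (moyal (hderiv i h) g))).
rewrite -linearD moyal_var -addrA [X in _ + X]addrC -hderiv_moyal.
rewrite (symmetrization_var k_char0 wP) IHf IHD -mulrDl -linearD.
by rewrite (symmetrization_var k_char0 wP) mulrA.
Qed.

End Moyal.

(** * Injectivity of the embedding into the enveloping algebra, and the star product *)

(** An action that respects the relations descends to the quotient, so it can separate classes
    there. *)
Lemma freealg_act_ideal (k : fieldType) (T : choiceType) (V : lmodType k)
    (op : T -> V -> V) (R : freealg k T -> freealg k T -> Prop) g :
    (forall t, linear (op t)) ->
    (forall u v, R u v -> forall x, freealg_act op u x = freealg_act op v x) ->
  rel_ideal R g -> forall x, freealg_act op g x = 0.
Proof.
move=> op_lin actR.
have act0 u : freealg_act op u 0 = 0.
  by have := freealg_act_linr op_lin u (-1) 0 0; rewrite scaler0 add0r scaleN1r addNr.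
elim=> {g} [u v Ruv x|x|u v _ IHu _ IHv x|a u _ IHu x|a u _ IHu x].
- by rewrite freealg_actDl freealg_actNl (actR _ _ Ruv) subrr.
- exact: freealg_act0l.
- by rewrite freealg_actDl IHu IHv addr0.
- by rewrite (freealg_actM op_lin) IHu act0.
- by rewrite (freealg_actM op_lin) IHu.
Qed.

(* [A (x) A^op] acts on [A] by two-sided multiplication, and [a (x) 1] maps [1]
   to [a]. *)
Lemma alg_tens1_inj (k : fieldType) (A : algType k) :
  injective (fun a : A => alg_tens a 1).
Proof.
pose op (u : tensor_idx A A^c) (x : A) : A := u.1 * x * (u.2 : A).
have op_lin u : linear (op u).
  by move=> c x y; rewrite /op mulrDr mulrDl -scalerAr -scalerAl.
move=> a b /(quotalg_piP (@alg_env_consistent k A)).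
move=> /(@freealg_act_ideal _ _ _ op _ _ op_lin) act0.
apply/eqP; rewrite -subr_eq0; apply/eqP; rewrite -[RHS](act0 _ 1).
  by rewrite freealg_actDl freealg_actNl !freealg_act_gen /op /= !mulr1.
move=> {a b act0} u v.
case=> [c a a' b|c a b b'|a a' b b'|] x; rewrite ?(freealg_actE op_lin) /op /=.
- by rewrite !mulrDl -!scalerAl.
- by rewrite mulrDr scalerAr.
- by rewrite -[(b * b' : A)]/((b' : A) * (b : A)) !mulrA.
- by rewrite mul1r mulr1.
Qed.

Theorem lemma6 (k : fieldType) (k_char0 : [pchar k] =i pred0)
    (n : nat) (n_gt0 : (0 < n)%N)
    (theta : {lrmorphism alg_env (weyl k n) -> poisson_env (std_poisson k n)})
    (theta_bij : bijective theta) (thetaP : is_theta theta)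
    (w : {linear {mpoly k[n + n]} -> weyl k n})
    (w_bij : bijective w) (wP : is_symmetrization w) :
  let rho_w := fun f : {mpoly k[n + n]} => theta (alg_tens (w f) 1) in
  injective rho_w /\
  forall f g : {mpoly k[n + n]},
    rho_w (star rho_w f g) = rho_w f * rho_w g /\
    star rho_w f g =
      \sum_(a \in [set: 'X_{1..n + n}])
        ((-1) ^+ mdeg2 a / ((mfact a)%:R * 2%:R ^+ mdeg a))
          *: (f^`M[a] * g^`M[mswap a]).
Proof.
move=> rho_w.
have rho_inj : injective rho_w.
  by move=> f g /(bij_inj theta_bij) /alg_tens1_inj /(bij_inj w_bij).
split=> // f g.
have rhoM : rho_w (moyal f g) = rho_w f * rho_w g.
  rewrite /rho_w (symmetrization_moyal k_char0 wP) -rmorphM.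
  by rewrite -[X in alg_tens _ X]mulr1 alg_tensM.
(* [rhoM] exhibits a preimage, so [star] does not fall back on its default 0; injectivity then
   identifies it with [moyal f g]. *)
have starM : rho_w (star rho_w f g) = rho_w f * rho_w g.
  exact: (xgetPex 0 (ex_intro [set r | rho_w r = rho_w f * rho_w g]%classic _ rhoM)).
by split=> //; apply: rho_inj; rewrite starM -rhoM.
Qed.
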